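(* Let $\alpha,\beta\in\mathbb{N}_0$ and let $M,N>0$ be real numbers. Let $$L_{2\alpha+2\beta+6,x}^{\alpha,\beta,M,N}\,y(x)=\Big[L_{2,x}^{\alpha,\beta}+\frac{M}{b_{\beta,\alpha}}\widetilde L_{2\beta+4,x}^{\beta,\alpha}+\frac{N}{b_{\alpha,\beta}}L_{2\alpha+4,x}^{\alpha,\beta}+\frac{MN}{c_{\alpha,\beta}}L_{2\alpha+2\beta+6,x}^{\alpha,\beta}\Big]y(x).$$ Then for all $f,g\in C^{(2\alpha+2\beta+6)}[-1,1]$, $$\big(L_{2\alpha+2\beta+6,x}^{\alpha,\beta,M,N}f,\,g\big)_{w(\alpha,\beta,M,N)}=\big(f,\,L_{2\alpha+2\beta+6,x}^{\alpha,\beta,M,N}g\big)_{w(\alpha,\beta,M,N)}.$$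
   Context: $\mathbb{N}_0=\{0,1,2,\dots\}$; $(a)_k=a(a+1)\cdots(a+k-1)$, $(a)_0=1$; $D_x^i$ denotes $i$-fold differentiation with respect to $x$, acting on everything inside the bracket that follows. $C^{(k)}[-1,1]$ is the space of $k$ times continuously differentiable functions on $[-1,1]$. Constants: $b_{\alpha,\beta}=(\alpha+2)!\,(\beta+1)_{\alpha+1}$ (so $b_{\beta,\alpha}=(\beta+2)!\,(\alpha+1)_{\beta+1}$), $c_{\alpha,\beta}=(\alpha+1)(\beta+1)(\alpha+\beta+3)\big((\alpha+\beta+1)!\big)^2$, and $h_{\alpha,\beta}=\int_{-1}^1(1-x)^\alpha(1+x)^\beta dx$. Scalar product: $(f,g)_{w(\alpha,\beta,M,N)}=(f,g)_{w(\alpha,\beta)}+Mf(-1)g(-1)+Nf(1)g(1)$, where $(f,g)_{w(\alpha,\beta)}=h_{\alpha,\beta}^{-1}\int_{-1}^{1}f(x)g(x)(1-x)^{\alpha}(1+x)^{\beta}dx$, for $f,g\in C[-1,1]$. Differential operators: $L_{2,x}^{\alpha,\beta}y(x)=\frac{1}{(x-1)^{\alpha}(x+1)^{\beta}}D_x\big[(x-1)^{\alpha+1}(x+1)^{\beta+1}D_xy(x)\big]$, $\widetilde L_{2\beta+4,x}^{\beta,\alpha}y(x)=\frac{x+1}{(x-1)^{\alpha}}D_x^{\beta+2}\big\{(x-1)^{\alpha+\beta+2}D_x^{\beta+2}\big[(x+1)^{\beta+1}y(x)\big]\big\}$, $L_{2\alpha+4,x}^{\alpha,\beta}y(x)=\frac{x-1}{(x+1)^{\beta}}D_x^{\alpha+2}\big\{(x+1)^{\alpha+\beta+2}D_x^{\alpha+2}\big[(x-1)^{\alpha+1}y(x)\big]\big\}$,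 $L_{2\alpha+2\beta+6,x}^{\alpha,\beta}y(x)=(x^2-1)D_x^{\alpha+\beta+3}\big\{(x-1)^{\beta+1}(x+1)^{\alpha+1}D_x^{\alpha+\beta+3}\big[(x-1)^{\alpha+1}(x+1)^{\beta+1}y(x)\big]\big\}$. Expanded in powers of $D_x$, all four are linear differential operators with polynomial coefficients, and their values at $x=\pm1$ are understood in this sense (i.e. the formulas are extended by continuity to $x=\pm1$). *)

(* Defs.v *)
From HB Require Import structures.
From mathcomp Require Import all_boot all_order all_algebra.
From mathcomp Require Import all_classical all_reals all_analysis.

Set Implicit Arguments.
Unset Strict Implicit.
Unset Printing Implicit Defensive.

Import Order.TTheory GRing.Theory Num.Theory.
Import numFieldNormedType.Exports.

Local Open Scope classical_set_scope.
Local Open Scope ring_scope.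

(* A function on [-1,1] is a total function R -> R whose values outside [-1,1]
   are irrelevant.  The limit is taken inside [-1,1], so that the derivative is
   one-sided at -1 and at 1. *)
Definition is_derive_on {R : realType} (f f' : R -> R) : Prop :=
  forall x : R, x \in `[(-1 : R), 1] ->
    (f t - f x) / (t - x) @[t --> within `[(-1 : R), 1] x^'] --> f' x.

Fixpoint Ck {R : realType} (k : nat) (f : R -> R) : Prop :=
  if k is k'.+1 then exists f' : R -> R, is_derive_on f f' /\ Ck k' f'
  else {within `[(-1 : R), 1], continuous f}.

Definition poch (a k : nat) : nat := (\prod_(i < k) (a + i))%N.

Definition b_cst (alpha beta : nat) : nat :=
  ((alpha + 2)`! * poch (beta + 1) (alpha + 1))%N.

Definition c_cst (alpha beta : nat) : nat :=
  ((alpha + 1) * (beta + 1) * (alpha + beta + 3) *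
   ((alpha + beta + 1)`!) ^ 2)%N.

Definition h_cst (R : realType) (alpha beta : nat) : R :=
  \int[lebesgue_measure]_(x in `[(-1 : R), 1])
    ((1 - x) ^+ alpha * (1 + x) ^+ beta).

Definition sprod_w {R : realType} (alpha beta : nat) (f g : R -> R) : R :=
  (h_cst R alpha beta)^-1 *
  \int[lebesgue_measure]_(x in `[(-1 : R), 1])
    (f x * g x * (1 - x) ^+ alpha * (1 + x) ^+ beta).

Definition sprod_wMN {R : realType} (alpha beta : nat) (M N : R)
    (f g : R -> R) : R :=
  sprod_w alpha beta f g + M * f (-1) * g (-1) + N * f 1 * g 1.

(* The formulas of the differential operators divide by powers of x - 1 and
   x + 1 and differentiate a function that is only relevant on [-1,1]; they are
   used literally on ]-1,1[ and extended by continuity to -1 and 1. *)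
Definition cont_ext {R : realType} (F : R -> R) (x : R) : R :=
  if x == -1 then lim (F t @[t --> (-1 : R)^'+])
  else if x == 1 then lim (F t @[t --> (1 : R)^'-])
  else F x.

Definition Dx {R : realType} (i : nat) (f : R -> R) : R -> R := derive1n i f.

Definition L2 {R : realType} (alpha beta : nat) (y : R -> R) : R -> R :=
  cont_ext (fun x =>
    1 / ((x - 1) ^+ alpha * (x + 1) ^+ beta) *
    Dx 1 (fun t =>
      (t - 1) ^+ (alpha + 1) * (t + 1) ^+ (beta + 1) * Dx 1 y t) x).

(* The arguments are in the order of the superscripts: beta, then alpha. *)
Definition Ltilde {R : realType} (beta alpha : nat) (y : R -> R) : R -> R :=
  cont_ext (fun x =>
    (x + 1) / (x - 1) ^+ alpha *
    Dx (beta + 2) (fun t =>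
      (t - 1) ^+ (alpha + beta + 2) *
      Dx (beta + 2) (fun s => (s + 1) ^+ (beta + 1) * y s) t) x).

Definition L2a4 {R : realType} (alpha beta : nat) (y : R -> R) : R -> R :=
  cont_ext (fun x =>
    (x - 1) / (x + 1) ^+ beta *
    Dx (alpha + 2) (fun t =>
      (t + 1) ^+ (alpha + beta + 2) *
      Dx (alpha + 2) (fun s => (s - 1) ^+ (alpha + 1) * y s) t) x).

Definition L2a2b6 {R : realType} (alpha beta : nat) (y : R -> R) : R -> R :=
  cont_ext (fun x =>
    (x ^+ 2 - 1) *
    Dx (alpha + beta + 3) (fun t =>
      (t - 1) ^+ (beta + 1) * (t + 1) ^+ (alpha + 1) *
      Dx (alpha + beta + 3) (fun s =>
        (s - 1) ^+ (alpha + 1) * (s + 1) ^+ (beta + 1) * y s) t) x).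

Definition LMN {R : realType} (alpha beta : nat) (M N : R) (y : R -> R)
    (x : R) : R :=
  L2 alpha beta y x
  + M / (b_cst beta alpha)%:R * Ltilde beta alpha y x
  + N / (b_cst alpha beta)%:R * L2a4 alpha beta y x
  + M * N / (c_cst alpha beta)%:R * L2a2b6 alpha beta y x.

(* Main.v *)
(** Each of the four operators has the form
      [w' T y = q D^n [p D^n [q y]]]  with  [w' = (x-1)^a (x+1)^b],
    [q = (x-1)^i (x+1)^j], [i] in {0, a+1}, [j] in {0, b+1}, [n = 1+i+j] and
    [p = (x-1)^(a+1-i+j) (x+1)^(b+1-j+i)].  Integrating [(T f, g)_w] by parts
    [n] times leaves the symmetric term [(-1)^n int p D^n[qf] D^n[qg]] and
    boundary terms; as [q] and [p] vanish to high order at the endpoints, at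
    most one boundary term survives at each of them.  The surviving terms of the
    operators with coefficients M/b and N/b cancel the point masses of [L2 f],
    and those of the operator with coefficient MN/c cancel the remaining point
    masses of the former.  Functions that are C^k on [-1,1] are
    extended to C^k functions on the line, by polynomials outside
    [-1,1]. *)

Require Import Defs.
From mathcomp Require Import all_boot all_order all_algebra.
From mathcomp Require Import all_classical all_reals all_analysis.
From mathcomp Require Import ring lra zify.
Import Order.TTheory GRing.Theory Num.Theory.
Import numFieldNormedType.Exports.
Local Open Scope ring_scope.

(** * C^k functions on the line *)

(** Derivatives here are two-sided and taken on the whole line, so that [derive1] and [derive1n]
    apply without one-sided cases at -1 and 1. *)
Fixpoint contdiff {R : realType} (k : nat) (f : R -> R) : Prop :=
  if k is k'.+1 then (forall x : R, derivable f x 1) /\ contdiff k' (derive1 f)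
  else continuous f.

Section Calculus.
Context {R : realType}.
Implicit Types (f g : R -> R) (c x : R).

Lemma contdiff_continuous k f : contdiff k f -> continuous f.
Proof.
case: k => //= k [df _] x.
exact/differentiable_continuous/derivable1_diffP.
Qed.

Lemma contdiffW k f : contdiff k.+1 f -> contdiff k f.
Proof.
elim: k f => [|k IH] f; first exact: contdiff_continuous.
by move=> [df Cf]; split => //; exact: IH.
Qed.

Lemma contdiff_le {k l f} : contdiff k f -> (l <= k)%N -> contdiff l f.
Proof.
move=> Cf lk; move: Cf; rewrite -(subnKC lk).
elim: (k - l)%N => [|m IH]; first by rewrite addn0.
by rewrite addnS => /contdiffW.
Qed.

Lemma derive1nSr n f : derive1n n.+1 f = derive1n n (derive1 f).
Proof. by rewrite /derive1n iterSr. Qed.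

Lemma contdiff_derive1n {k n f} : contdiff (n + k) f -> contdiff k (derive1n n f).
Proof.
elim: n f => [|n IH] f; first by rewrite derive1n0.
by move=> [_ Cf]; rewrite derive1nSr; exact: IH.
Qed.

Lemma contdiff_derivable {n m f} : contdiff n f -> (m < n)%N ->
  forall x, derivable (derive1n m f) x 1.
Proof.
move=> Cf mn x; have : contdiff 1 (derive1n m f).
  by apply: contdiff_derive1n; apply: contdiff_le Cf _; rewrite addn1.
by case.
Qed.

Lemma contdiff_cst k c : contdiff k (fun=> c).
Proof.
elim: k c => [|k IH] c /=; first by move=> x; exact: cvg_cst.
split=> [x|]; first exact: derivable_cst.
rewrite (_ : derive1 _ = fun=> 0) //.
by apply/funext => x; rewrite derive1_cst.
Qed.

Lemma derive1D f g : (forall x, derivable f x 1) -> (forall x, derivable g x 1) ->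
  derive1 (fun x => f x + g x) = fun x => derive1 f x + derive1 g x.
Proof.
move=> df dg; apply/funext => x; rewrite !derive1E.
exact: (deriveD (df x) (dg x)).
Qed.

Lemma derive1M f g : (forall x, derivable f x 1) -> (forall x, derivable g x 1) ->
  derive1 (fun x => f x * g x) = fun x => derive1 f x * g x + f x * derive1 g x.
Proof.
move=> df dg; apply/funext => x; rewrite !derive1E deriveM //.
by rewrite addrC [X in _ = X + _]mulrC.
Qed.

Lemma contdiffD k f g : contdiff k f -> contdiff k g -> contdiff k (fun x => f x + g x).
Proof.
elim: k f g => [|k IH] f g /=.
  by move=> cf cg x; apply: cvgD; [exact: cf|exact: cg].
move=> [df Cf] [dg Cg]; split=> [x|]; first exact: derivableD.
by rewrite derive1D //; exact: IH.
Qed.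

Lemma contdiffM k f g : contdiff k f -> contdiff k g -> contdiff k (fun x => f x * g x).
Proof.
elim: k f g => [|k IH] f g.
  by move=> cf cg x; apply: cvgM; [exact: cf|exact: cg].
move=> Cf Cg; have [[df Cf'] [dg Cg']] := (Cf, Cg).
split=> [x|]; first exact: derivableM.
by rewrite derive1M //; apply: contdiffD; apply: IH => //; exact: contdiffW.
Qed.

(** * Powers of x - c and Leibniz' rule *)

Lemma derivable_subr c x : derivable (fun t : R => t - c) x 1.
Proof. by apply: derivableB; [exact: derivable_id|exact: derivable_cst]. Qed.

Lemma derive1_subr c : derive1 (fun t : R => t - c) = fun=> 1.
Proof.
apply/funext => x; rewrite derive1E deriveB //.
by rewrite derive_id derive_cst subr0.
Qed.

Lemma contdiff_subr k c : contdiff k (fun x : R => x - c).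
Proof.
case: k => [|k]; first by move=> x; apply: cvgB; [exact: cvg_id|exact: cvg_cst].
split; first exact: derivable_subr.
by rewrite derive1_subr; exact: contdiff_cst.
Qed.

Lemma contdiff_subrX k c n : contdiff k (fun x : R => (x - c) ^+ n).
Proof.
elim: n => [|n IH].
  by under eq_fun do rewrite expr0; exact: contdiff_cst.
by under eq_fun do rewrite exprS; apply: contdiffM IH; exact: contdiff_subr.
Qed.

Lemma derive1_subrX c n :
  derive1 (fun x : R => (x - c) ^+ n.+1) = fun x => n.+1%:R * (x - c) ^+ n.
Proof.
elim: n => [|n IH].
  under eq_fun do rewrite expr1.
  by rewrite derive1_subr; apply/funext => x; rewrite expr0 mulr1.
under eq_fun do rewrite exprS.
have [d _] := contdiff_subrX 1 c n.+1.
rewrite derive1M; [|exact: derivable_subr|exact: d].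
rewrite IH derive1_subr; apply/funext => x.
by rewrite exprS mul1r -[n.+2]addn1 natrD; ring.
Qed.

Lemma derive1nM_subr c n f : contdiff n.+1 f ->
  derive1n n.+1 (fun x => (x - c) * f x) =
  fun x => (x - c) * derive1n n.+1 f x + n.+1%:R * derive1n n f x.
Proof.
elim: n => [|n IH] Cf.
  have [df _] := Cf.
  rewrite !derive1n1 derive1M; [|exact: derivable_subr|exact: df].
  by rewrite derive1_subr derive1n0; apply/funext => x; rewrite addrC.
rewrite derive1nS IH; last exact: contdiffW.
have d1 := contdiff_derivable Cf (ltnSn n.+1).
have d2 := contdiff_derivable Cf (ltnW (ltnSn n.+1)).
rewrite derive1D; last 2 first.
- by move=> x; apply: derivableM => //; exact: derivable_subr.
- by move=> x; apply: derivableM => //; exact: derivable_cst.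
rewrite derive1M; [|exact: derivable_subr|exact: d1].
rewrite derive1M; [|by move=> x; exact: derivable_cst|exact: d2].
rewrite derive1_subr -!derive1nS; apply/funext => x.
by rewrite derive1_cst -(addn1 n.+1) natrD; ring.
Qed.

(** In Leibniz' rule at x = c only the term with exactly m derivatives on (x - c)^m survives, and
    binom(n,m) m! is the falling factorial. For n < m that factor is 0, so the truncated [n - m] is
    harmless. *)
Lemma derive1nM_subrX_at c n m f : contdiff n f ->
  derive1n n (fun x => (x - c) ^+ m * f x) c =
  (n ^_ m)%:R * derive1n (n - m) f c.
Proof.
elim: m n => [|m IH] n Cf.
  rewrite ffactn0 mul1r subn0; congr (derive1n n _ c).
  by apply/funext => x; rewrite expr0 mul1r.
under eq_fun do rewrite exprS -mulrA.
case: n Cf => [|n] Cf.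
  by rewrite derive1n0 subrr !mul0r.
rewrite derive1nM_subr; last by apply: contdiffM => //; exact: contdiff_subrX.
rewrite subrr mul0r add0r IH; last exact: contdiffW.
by rewrite ffactSS natrM mulrA subSS.
Qed.

(** Each derivative costs at most one power of x - c, so (x - c)^m still factors out. [K] is built
    without any division, hence stays regular at c; it gives meaning there to operators that divide
    by a power of x - c. *)
Lemma derive1nM_subrX_factor c m k s f : contdiff (k + s) f ->
  exists K, [/\ contdiff s K, K c = ((m + k) ^_ k)%:R * f c &
    derive1n k (fun x => (x - c) ^+ (m + k) * f x) =
    fun x => (x - c) ^+ m * K x].
Proof.
elim: k f => [|k IH] f Cf.
  by exists f; rewrite addn0 ffactn0 mul1r derive1n0.
have [df Cf'] := Cf.
(* [g] is the derivative of (x - c)^(m+k+1) f with (x - c)^(m+k) factored out. *)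
pose g x := (m + k).+1%:R * f x + (x - c) * derive1 f x.
have /IH[K [CK Kc KE]] : contdiff (k + s) g.
  apply: contdiffD; apply: contdiffM => //.
  - exact: contdiff_cst.
  - exact: contdiffW.
  - exact: contdiff_subr.
exists K; split=> //.
  rewrite Kc /g subrr mul0r addr0 addnS ffactSS mulrA -natrM.
  by rewrite mulnC.
rewrite addnS derive1nSr -KE; congr (derive1n k _).
rewrite derive1M //; last by have [] := contdiff_subrX 1 c (m + k).+1.
by rewrite derive1_subrX; apply/funext => x; rewrite /g exprS; ring.
Qed.

(** Differentiation is local. On the open interval this lets an operator applied to [f] be computed
    on an extension of [f]. *)
Lemma derive1n_eq_oo n f g (a b : R) : {in `]a, b[, f =1 g} ->
  {in `]a, b[, derive1n n f =1 derive1n n g}.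
Proof.
elim: n => // n IH fg x xab; rewrite !derive1nS !derive1E.
apply: near_eq_derive.
by near=> y; apply: IH => //; near: y; exact: near_in_itvoo.
Unshelve. all: by end_near. Qed.

End Calculus.

(** * Extension of C^k functions from [-1,1] to the line *)

Section Extension.
Local Open Scope classical_set_scope.
Local Open Scope ring_scope.
Context {R : realType}.
Implicit Types (f g : R -> R) (P Q : {poly R}).

(** Links [is_derive] to the quotient form used in [is_derive_on]. The translation is Caratheodory's
    slope function, with value [l] at x. *)
Lemma is_derive_quotient f (x l : R) :
  is_derive x 1 f l <->
  ((f t - f x) / (t - x) @[t --> x^'] --> l)%classic.
Proof.
split=> [/is_derive1_caratheodory[h [fE hc <-]]|fl].
  move/continuous_withinNx : hc => hc; apply: cvg_trans hc.
  apply: near_eq_cvg; near=> t.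
  rewrite fE mulfK // subr_eq0; near: t; exact: nbhs_dnbhs_neq.
apply/is_derive1_caratheodory.
exists (fun t => if t == x then l else (f t - f x) / (t - x)); split.
- move=> t; have [->|tx] := eqVneq t x; first by rewrite !subrr mulr0.
  by rewrite -mulrA mulVf ?mulr1 // subr_eq0.
- apply/continuous_withinNx; rewrite eqxx; apply: cvg_trans fl.
  apply: near_eq_cvg; near=> t.
  suff /negbTE -> : t != x by [].
  near: t; exact: nbhs_dnbhs_neq.
- by rewrite eqxx.
Unshelve. all: by end_near. Qed.

Lemma antideriv_exists P (c a : R) :
  exists Q : {poly R}, Q^`() = P /\ Q.[c] = a.
Proof.
(* At i = 0 the division by zero gives the coefficient 0; the constant term is adjusted afterwards
   to obtain the value [a] at [c]. *)
pose Q : {poly R} := \poly_(i < (size P).+1) (P`_i.-1 / i%:R).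
have QP : Q^`() = P.
  apply/polyP => i; rewrite coef_deriv coef_poly ltnS /=.
  case: ltnP => iP; last by rewrite mul0rn nth_default.
  by rewrite -[LHS]mulr_natr divfK // pnatr_eq0.
exists (Q + (a - Q.[c])%:P); split; first by rewrite derivD derivC addr0.
by rewrite hornerD hornerC addrC subrK.
Qed.

Definition glue P f Q (x : R) : R :=
  if x < -1 then P.[x] else if x <= 1 then f x else Q.[x].

Lemma glueE P f Q : {in `[(-1 : R), 1], glue P f Q =1 f}.
Proof. by move=> x; rewrite in_itv /= /glue leNgt => /andP[/negbTE -> ->]. Qed.

Lemma glue_r P f Q (x : R) : Q.[1] = f 1 -> 1 <= x -> glue P f Q x = Q.[x].
Proof.
move=> Q1 x1; have m1 : -1 <= x by lra.
rewrite /glue ltNge m1 /=; case: leP => // x1'.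
by have -> : x = 1 by lra.
Qed.

Lemma glue_l P f Q (x : R) : P.[-1] = f (-1) -> x <= -1 -> glue P f Q x = P.[x].
Proof.
move=> P1 x1; rewrite /glue; case: ltP => // x1'.
have x2 : x <= 1 by lra.
by rewrite x2; have -> : x = -1 by lra.
Qed.

(** The line is cut into three closed pieces, and a point t near x lies in a piece that also
    contains x. There the difference quotient is that of [P], [f] or [Q]; at -1 and 1, where two
    pieces meet, the matching values and derivatives give both the same limit. *)
Lemma is_derive_glue P f f' Q :
  is_derive_on f f' ->
  P.[-1] = f (-1) -> Q.[1] = f 1 -> P^`().[-1] = f' (-1) -> Q^`().[1] = f' 1 ->
  forall x : R, is_derive x 1 (glue P f Q) (glue P^`() f' Q^`() x).
Proof.
move=> df P1 Q1 dP1 dQ1 x.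
set g := glue P f Q; set l := glue _ _ _ x.
apply/is_derive_quotient/cvgrPdist_le => e e0.
have polyq (S : {poly R}) :
    \forall t \near x^', `|S^`().[x] - (S.[t] - S.[x]) / (t - x)| <= e.
  have /is_derive_quotient/cvgrPdist_le := @is_derive_poly _ S x; exact.
have Hr : \forall t \near x^', 1 <= x -> 1 <= t ->
    `|l - (g t - g x) / (t - x)| <= e.
  have [x1|_] := leP 1 x; last exact: nearW.
  rewrite /l /g glue_r // (glue_r P f _ x) //.
  by near=> t => _ t1; rewrite glue_r //; near: t; exact: polyq.
have Hl : \forall t \near x^', x <= -1 -> t <= -1 ->
    `|l - (g t - g x) / (t - x)| <= e.
  have [x1|_] := leP x (-1); last exact: nearW.
  rewrite /l /g glue_l // (glue_l P f _ x) //.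
  by near=> t => _ t1; rewrite glue_l //; near: t; exact: polyq.
have Hm : \forall t \near x^', x \in `[(-1 : R), 1] -> t \in `[(-1 : R), 1] ->
    `|l - (g t - g x) / (t - x)| <= e.
  have [x1|_] := boolP (x \in `[(-1 : R), 1]); last exact: nearW.
  have /cvgrPdist_le/(_ e e0) := df x x1.
  rewrite /l /g glueE // (glueE P f Q x x1) => H.
  have {}H : \forall t \near x^', t \in `[(-1 : R), 1] ->
      `|f' x - (f t - f x) / (t - x)| <= e.
    exact: H.
  by apply: filterS H => t Ht _ t1; rewrite glueE //; exact: Ht.
(* Every t close to x shares a closed piece with x; the five positions of x relative to -1 and 1 are
   treated in turn. *)
have Hp : \forall t \near x^', [\/ x <= -1 /\ t <= -1,
     x \in `[(-1 : R), 1] /\ t \in `[(-1 : R), 1] | 1 <= x /\ 1 <= t].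
  have near2 (a b : R) : a < x < b -> \forall t \near x^', a <= t <= b.
    move=> xab; apply: nbhs_dnbhs.
    have : x \in `]a, b[ by rewrite in_itv.
    move=> /near_in_itvoo; apply: filterS => t.
    by rewrite in_itv /= => /andP[/ltW -> /ltW ->].
  have tri (a : R) : [\/ x < a, x = a | a < x].
    by case: (ltgtP x a) => h; [constructor 1|constructor 3|constructor 2].
  have [x1|x1|x1] := tri (-1).
  - near=> t; have /andP[? ?] : x - 1 <= t <= -1.
      by near: t; apply: near2; apply/andP; split; lra.
    by constructor 1; lra.
  - near=> t; have /andP[? ?] : -2 <= t <= 1.
      by near: t; apply: near2; apply/andP; split; lra.
    rewrite !in_itv /=; have [tn|tn] := leP t (-1); first by constructor 1; lra.
    by constructor 2; split; apply/andP; lra.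
  - have [y1|y1|y1] := tri 1.
    + near=> t; have /andP[? ?] : -1 <= t <= 1.
        by near: t; apply: near2; apply/andP; split; lra.
      rewrite !in_itv /=; constructor 2.
      by split; apply/andP; split; lra.
    + near=> t; have /andP[? ?] : -1 <= t <= 2.
        by near: t; apply: near2; apply/andP; split; lra.
      rewrite !in_itv /=; have [tn|tn] := leP t 1; last by constructor 3; lra.
      by constructor 2; split; apply/andP; split; lra.
    + near=> t; have /andP[? ?] : 1 <= t <= x + 1.
        by near: t; apply: near2; apply/andP; split; lra.
      by constructor 3; lra.
near=> t; have [[]|[]|[]] : [\/ x <= -1 /\ t <= -1,
     x \in `[(-1 : R), 1] /\ t \in `[(-1 : R), 1] | 1 <= x /\ 1 <= t].
- by near: t.
- by near: t; exact: Hl.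
- by near: t; exact: Hm.
- by near: t; exact: Hr.
Unshelve. all: by end_near. Qed.

Lemma continuous_glue f : {within `[(-1 : R), 1], continuous f}%classic ->
  continuous (glue (f (-1))%:P f (f 1)%:P).
Proof.
move=> /subspace_continuousP cf.
(* [cl] is the projection onto [-1,1]. With constant outer pieces the glued function is f composed
   with [cl], hence continuous. *)
pose cl (x : R) := Num.max (-1) (Num.min x 1).
have cl_in x : cl x \in `[(-1 : R), 1].
  rewrite in_itv /= /cl le_max lexx /= ge_max ge_min lexx orbT andbT.
  by lra.
have -> : glue (f (-1))%:P f (f 1)%:P = f \o cl.
  apply/funext => x; rewrite /glue /cl /= !hornerC.
  case: (leP x 1) => x1; case: ltP => x2 //.
  - by lra.
  - by rewrite (_ : Num.max (-1) 1 = 1) //; apply/max_idPr; lra.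
have ccl : continuous cl.
  move=> x.
  have cmin : {for x, continuous (fun x : R => Num.min x 1 : R^o)}.
    have := @continuous_min R R (fun x => x) (fun=> 1) x; apply.
      exact: cvg_id.
    exact: cvg_cst.
  have := @continuous_max R R (fun=> -1) (fun x => Num.min x 1) x; apply.
    exact: cvg_cst.
  exact: cmin.
move=> x; apply/cvgrPdist_le => e e0.
have /cvgrPdist_le/(_ e e0) := cf (cl x) (cl_in x).
rewrite near_withinE => H.
have {}H : \forall t \near x, cl t \in `[(-1 : R), 1] ->
  `|f (cl x) - f (cl t)| <= e := ccl x _ H.
by apply: filterS H => t Ht; apply: Ht; exact: cl_in.
Qed.

Lemma Ck_extension k f : Ck k f ->
  exists F, contdiff k F /\ {in `[(-1 : R), 1], F =1 f}.
Proof.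
(* The induction needs the outer pieces to be polynomials: those found for f' are integrated, with
   constants fixed by the values of f at -1 and 1. *)
suff H : Ck k f -> exists P Q,
    [/\ P.[-1] = f (-1), Q.[1] = f 1 & contdiff k (glue P f Q)].
  by move=> /H[P [Q [_ _ C]]]; exists (glue P f Q); split=> //; exact: glueE.
elim: k f => [|k IH] f /=.
  move=> /continuous_glue cf; exists (f (-1))%:P, (f 1)%:P.
  by rewrite !hornerC.
move=> [f' [ff' /IH[P' [Q' [P1 Q1 C']]]]].
have [P [PE P1']] := antideriv_exists P' (-1) (f (-1)).
have [Q [QE Q1']] := antideriv_exists Q' 1 (f 1).
exists P, Q; split => //.
rewrite -PE -QE in P1 Q1 C'.
have D := is_derive_glue _ _ _ _ ff' P1' Q1' P1 Q1.
split=> [x|]; first by have := D x; case.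
rewrite (_ : derive1 _ = glue P^`() f' Q^`()) //.
by apply/funext => x; rewrite derive1E derive_val.
Qed.
End Extension.

(** * Iterated integration by parts *)

Section Parts.
Context {R : realType}.
Local Open Scope classical_set_scope.
Local Open Scope ring_scope.
Implicit Types (f g F G U H : R -> R) (c : R).

Definition Int f : R := \int[lebesgue_measure]_(x in `[(-1 : R), 1]) f x.

Lemma eq_Int f g : {in `[(-1 : R), 1], f =1 g} -> Int f = Int g.
Proof.
by move=> fg; apply: eq_Rintegral => x; rewrite inE => /fg.
Qed.

Lemma integrable_continuous f : continuous f ->
  lebesgue_measure.-integrable `[(-1 : R), 1] (EFin \o f).
Proof.
move=> cf; apply: continuous_compact_integrable; first exact: segment_compact.
exact: continuous_subspaceT.
Qed.

Lemma IntD f g : continuous f -> continuous g ->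
  Int (fun x => f x + g x) = Int f + Int g.
Proof.
move=> cf cg; apply: RintegralD => //; exact: integrable_continuous.
Qed.

Lemma IntZl (a : R) f : continuous f -> Int (fun x => a * f x) = a * Int f.
Proof.
by move=> cf; apply: RintegralZl => //; exact: integrable_continuous.
Qed.

Lemma Int_by_parts F G : contdiff 1 F -> contdiff 1 G ->
  Int (fun x => F x * derive1 G x) =
  F 1 * G 1 - F (-1) * G (-1) - Int (fun x => derive1 F x * G x).
Proof.
move=> CF CG; have [[dF cF] [dG cG]] := (CF, CG).
have bnd H : contdiff 1 H -> derivable_oo_LRcontinuous H (-1) 1.
  move=> CH; split=> [x _||]; first by have [] := CH.
  - by apply: cvg_at_right_filter; exact: contdiff_continuous CH _.
  - by apply: cvg_at_left_filter; exact: contdiff_continuous CH _.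
apply: Rintegration_by_parts.
- by lra.
- exact: continuous_subspaceT.
- exact: bnd.
- by move=> x _.
- exact: continuous_subspaceT.
- exact: bnd.
- by move=> x _.
Qed.

(** The contribution of the endpoint c to n integrations by parts (the bilinear concomitant). For n
    = 0 the sum is empty, so [n.-1] is never read at 0. *)
Definition bdry n c G U : R :=
  \sum_(m < n) (-1) ^+ m * derive1n m G c * derive1n (n.-1 - m) U c.

Lemma bdryS n c G U :
  bdry n.+1 c G U = G c * derive1n n U c - bdry n c (derive1 G) U.
Proof.
rewrite /bdry big_ord_recl expr0 mul1r subn0 derive1n0; congr (_ + _).
rewrite -sumrN; apply: eq_bigr => m _.
rewrite !lift0 exprS derive1nSr (_ : (n.+1.-1 - m.+1 = n.-1 - m)%N); last by lia.
by rewrite !mulNr mul1r.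
Qed.

Lemma Int_by_parts_iter n G U : contdiff n G -> contdiff n U ->
  Int (fun x => G x * derive1n n U x) =
  bdry n 1 G U - bdry n (-1) G U + (-1) ^+ n * Int (fun x => derive1n n G x * U x).
Proof.
elim: n G => [|n IH] G CG CU.
  by rewrite /bdry !big_ord0 subrr add0r mul1r.
have CU1 : contdiff 1 (derive1n n U) by apply: contdiff_derive1n; rewrite addn1.
rewrite derive1nS Int_by_parts //; last exact: contdiff_le CG _.
rewrite IH; [|by have [] := CG|exact: contdiffW].
by rewrite !bdryS exprS derive1nSr; ring.
Qed.

(** Only derivatives of order less than n of the second function enter, and they all vanish at c. *)
Lemma bdry_eq0 n k c G H : contdiff n H -> (n <= k)%N ->
  bdry n c G (fun x => (x - c) ^+ k * H x) = 0.
Proof.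
move=> CH nk; rewrite /bdry big1 // => m _.
have lm := ltn_ord m.
rewrite derive1nM_subrX_at; last by apply: contdiff_le CH _; lia.
by rewrite ffact_small ?mul0r ?mulr0 //; lia.
Qed.

(** The orders of vanishing i and k add up to the total order of differentiation. For m < i the
    first factor vanishes at c, for m > i the second one does, and m = i remains. *)
Lemma bdry_one i k c G H : contdiff (i + k).+1 G -> contdiff (i + k).+1 H ->
  bdry (i + k).+1 c (fun x => (x - c) ^+ i * G x) (fun x => (x - c) ^+ k * H x) =
  (-1) ^+ i * (i`!)%:R * (k`!)%:R * G c * H c.
Proof.
move=> CG CH; rewrite /bdry.
have li : (i < (i + k).+1)%N by rewrite ltnS leq_addr.
rewrite (bigD1 (Ordinal li)) //= big1 ?addr0 => [|m mi].
  rewrite !derive1nM_subrX_at.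
  - rewrite addKn !ffactnn !subnn !derive1n0; ring.
  - by apply: contdiff_le CH _; lia.
  - by apply: contdiff_le CG _; lia.
have lm := ltn_ord m.
rewrite !derive1nM_subrX_at.
- have [mlt|] := ltnP m i.
    by rewrite ffact_small // mul0r mulr0 mul0r.
  move=> im; have im' : i != m by apply: contraNneq mi => im'; apply/eqP/val_inj.
  have -> : ((i + k - m) ^_ k = 0)%N by apply: ffact_small; lia.
  by rewrite mul0r mulr0.
- by apply: contdiff_le CH _; lia.
- by apply: contdiff_le CG _; lia.
Qed.

(* The weight (1-x)^a (1+x)^b up to the factor (-1)^a. *)
Definition wgt (a b : nat) (x : R) : R := (x - 1) ^+ a * (x + 1) ^+ b.

(** * Closed form of the weight integral *)

Lemma subrN1 x : x - -1 = x + 1 :> R.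
Proof. by rewrite opprK. Qed.

Lemma derive1n_scale_subrX n m (r c : R) :
  derive1n n (fun x : R => r * (x - c) ^+ (m + n)) =
  fun x => r * ((m + n) ^_ n)%:R * (x - c) ^+ m.
Proof.
elim: n r => [|n IH] r.
  by apply/funext => x; rewrite derive1n0 ffactn0 mulr1 addn0.
have [d _] := contdiff_subrX 1 c (m + n).+1.
rewrite addnS derive1nSr.
rewrite derive1M; [|by move=> x; exact: derivable_cst|exact: d].
rewrite derive1_subrX ffactSS.
have -> : (fun x : R => derive1 (fun=> r) x * (x - c) ^+ (m + n).+1 +
    r * ((m + n).+1%:R * (x - c) ^+ (m + n))) =
    (fun x => (r * (m + n).+1%:R) * (x - c) ^+ (m + n)).
  by apply/funext => x; rewrite derive1_cst mul0r add0r mulrA.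
by rewrite IH; apply/funext => x; rewrite natrM mulrA.
Qed.

Lemma opp_subrX (a : nat) (x : R) : (1 - x) ^+ a = (-1) ^+ a * (x - 1) ^+ a.
Proof. by rewrite -exprMn mulN1r opprB. Qed.

(** A Beta integral. Up to a constant, (1 + x)^b is the derivative of order a + 1 of (1 +
    x)^(a+b+1). Moving these derivatives onto (x - 1)^a kills the integral, the terms at -1 vanish,
    and one term is left at 1. *)
Lemma h_cstE (a b : nat) :
  h_cst R a b = 2 ^+ (a + b + 1) * (a`!)%:R * (b`!)%:R / ((a + b + 1)`!)%:R.
Proof.
(* The trivial factors [1] and [(x - 1) ^+ 0] give the shape required by [bdry_one] at 1 with i = a
   and k = 0. *)
pose G (x : R) := (x - 1) ^+ a * 1.
pose U (x : R) := (x - 1) ^+ 0 * (x - -1) ^+ (b + a.+1).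
have U2 : U = fun x => (x - -1) ^+ (b + a.+1) * 1.
  by apply/funext => x; rewrite /U expr0 mul1r mulr1.
have CG k : contdiff k G by apply: contdiffM; [exact: contdiff_subrX|exact: contdiff_cst].
have CU k : contdiff k U by apply: contdiffM; exact: contdiff_subrX.
have dG : derive1n a.+1 G = fun=> 0.
  rewrite derive1nS (_ : G = fun x => 1 * (x - 1) ^+ (0 + a)); last first.
    by apply/funext => x; rewrite /G mulr1 mul1r.
  rewrite derive1n_scale_subrX; apply/funext => x.
  by under eq_fun do rewrite expr0; rewrite derive1_cst.
have dU : derive1n a.+1 U = fun x => ((b + a.+1) ^_ a.+1)%:R * (x + 1) ^+ b.
  rewrite (_ : U = fun x => 1 * (x - -1) ^+ (b + a.+1)); last first.
    by apply/funext => x; rewrite /U expr0.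
  by rewrite derive1n_scale_subrX; apply/funext => x; rewrite mul1r opprK.
have := Int_by_parts_iter a.+1 G U (CG _) (CU _).
have B : bdry a.+1 (-1) G U = 0.
  by rewrite U2 bdry_eq0 ?leq_addl //; exact: contdiff_cst.
rewrite dG B.
rewrite -[X in bdry X.+1 1]addn0 bdry_one; [|exact: contdiff_cst|exact: contdiff_subrX].
have -> : Int (fun x => 0 * U x) = 0.
  rewrite (@eq_Int _ (fun x => 0 * 1)) => [|x _]; last by rewrite !mul0r.
  by rewrite IntZl ?mul0r //; exact: (contdiff_cst 0).
rewrite mulr0 addr0 subr0 dU.
have cw : continuous (fun x : R => (x - 1) ^+ a * (x + 1) ^+ b).
  have := contdiff_subrX 0 (-1 : R) b; under eq_fun do rewrite opprK.
  by move/(contdiffM 0 _ _ (contdiff_subrX 0 1 a)).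
rewrite (@eq_Int _ (fun x => ((b + a.+1) ^_ a.+1)%:R * ((x - 1) ^+ a * (x + 1) ^+ b)));
  last by move=> x _; rewrite /G; ring.
rewrite IntZl // => H.
have -> : h_cst R a b = (-1) ^+ a * Int (fun x => (x - 1) ^+ a * (x + 1) ^+ b).
  rewrite -IntZl //; apply: eq_Int => x _.
  by rewrite opp_subrX mulrA (addrC 1 x).
have f0 n : (n`!)%:R != 0 :> R by rewrite pnatr_eq0 -lt0n fact_gt0.
apply: (mulfI (f0 (a + b + 1)%N)).
have E : ((b + a.+1) ^_ a.+1 * b`! = (a + b + 1)`!)%N.
  have := @ffact_fact (b + a.+1) a.+1 (leq_addl _ _).
  by rewrite addnK => ->; congr (_`!); lia.
rewrite [RHS]mulrC divfK // -E natrM.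
rewrite [LHS](_ : _ = (-1) ^+ a * (b`!)%:R * (((b + a.+1) ^_ a.+1)%:R *
  Int (fun x => (x - 1) ^+ a * (x + 1) ^+ b))); last by ring.
rewrite H fact0 !mulr1 (_ : 1 - -1 = 2 :> R); last by ring.
rewrite (_ : b + a.+1 = a + b + 1)%N; last by lia.
rewrite [LHS](_ : _ = ((-1) ^+ a) ^+ 2 *
  (2 ^+ (a + b + 1) * (a`!)%:R * (b`!)%:R)); last by ring.
by rewrite sqrr_sign mul1r.
Qed.

End Parts.

(** * The differential operators *)

Section Operators.
Context {R : realType}.
Local Open Scope classical_set_scope.
Local Open Scope ring_scope.
Implicit Types (f g F G K : R -> R) (c d x : R).

(** Endpoint values of an operator can thus be read off from a continuous formula known only on the
    open interval. *)
Lemma cont_ext_continuous F K : continuous K -> {in `](-1 : R), 1[, F =1 K} ->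
  {in `[(-1 : R), 1], cont_ext F =1 K}.
Proof.
move=> cK FK x; rewrite in_itv /= => /andP[x1 x2]; rewrite /cont_ext.
have [->|xN1] := eqVneq x (-1).
  apply/cvg_lim => //; have /cvg_at_right_filter := cK (-1).
  apply: cvg_trans; apply: near_eq_cvg; near=> t.
  rewrite FK // in_itv /=; apply/andP; split; first by near: t; exact: nbhs_right_gt.
  by near: t; apply: nbhs_right_lt; lra.
have [->|x_1] := eqVneq x 1.
  apply/cvg_lim => //; have /cvg_at_left_filter := cK 1.
  apply: cvg_trans; apply: near_eq_cvg; near=> t.
  rewrite FK // in_itv /=; apply/andP; split; last by near: t; exact: nbhs_left_lt.
  by near: t; apply: nbhs_left_gt; lra.
by apply: FK; rewrite in_itv /= !lt_neqAle eq_sym xN1 x1 x_1 x2.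
Unshelve. all: by end_near. Qed.

(** * Fluxes, energies and operators singular at one endpoint *)

Definition flux n (p q y : R -> R) : R -> R :=
  fun x => p x * derive1n n (fun t => q t * y t) x.

(** The integral of p D^n[qF] D^n[qG], which remains after n integrations by parts. *)
Definition energy n (p q F G : R -> R) : R :=
  Int (fun x => derive1n n (fun t => q t * G t) x * flux n p q F x).

Lemma energyC n p q F G : energy n p q F G = energy n p q G F.
Proof. by apply: eq_Int => x _; rewrite /flux; ring. Qed.

Lemma eq_flux n p q p' q' f F :
  p =1 p' -> q =1 q' -> {in `](-1 : R), 1[, F =1 f} ->
  {in `](-1 : R), 1[, derive1n n (flux n p q f) =1 derive1n n (flux n p' q' F)}.
Proof.
move=> pp qq Ff; apply: derive1n_eq_oo => x xI; rewrite /flux pp; congr (_ * _).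
by apply: derive1n_eq_oo x xI => x xI; rewrite qq Ff.
Qed.

Lemma contdiff_flux n (p q F : R -> R) :
  contdiff n p -> contdiff (n + n) q -> contdiff (n + n) F -> contdiff n (flux n p q F).
Proof.
by move=> Cp Cq CF; apply: contdiffM => //; apply: contdiff_derive1n; exact: contdiffM.
Qed.

(* [c] is the endpoint at which the operator has a singular factor, [d] the
   other one. *)
Definition endpoint_op n c d a b (y : R -> R) x : R :=
  (x - d) / (x - c) ^+ a *
  derive1n n (flux n (fun t => (t - c) ^+ (a + n))
                     (fun t => (t - d) ^+ b) y) x.

(** After b + 2 derivatives the factor (x - c)^(a+b+2) still leaves (x - c)^a, which cancels the
    denominator. The outer factor x - d gives the zero at d. *)
Lemma endpoint_op_repr c d a b F : contdiff (b + 2 + (b + 2)) F ->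
  exists K,
    [/\ continuous K,
        forall x, x != c -> endpoint_op (b + 2) c d a (b + 1) F x = K x,
        forall x, K x * ((x - c) ^+ a * (x - d) ^+ b) = (x - d) ^+ (b + 1) *
          derive1n (b + 2) (flux (b + 2) (fun t => (t - c) ^+ (a + (b + 2)))
                     (fun t => (t - d) ^+ (b + 1)) F) x,
        K c = (c - d) * (((a + (b + 2)) ^_ (b + 2))%:R *
          derive1n (b + 2) (fun t => (t - d) ^+ (b + 1) * F t) c) &
        K d = 0].
Proof.
move=> CF; set n := (b + 2)%N in CF *.
have CH : contdiff (n + 0) (derive1n n (fun t => (t - d) ^+ (b + 1) * F t)).
  rewrite addn0; apply: contdiff_derive1n; apply: contdiffM => //.
  exact: contdiff_subrX.
have [K [CK Kc KE]] := derive1nM_subrX_factor c a n 0 _ CH.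
exists (fun x => (x - d) * K x); split.
- exact: (contdiffM 0 _ _ (contdiff_subr 0 d) CK).
- move=> x xc; rewrite /endpoint_op /flux KE -mulrA mulKf //.
  by rewrite expf_neq0 // subr_eq0.
- by move=> x; rewrite /flux KE addn1 exprS; ring.
- by rewrite Kc.
- by rewrite subrr mul0r.
Qed.

(** The flux vanishes at c to order at least a + b + 2, which is no less than the number of
    integrations by parts. *)
Lemma endpoint_op_bdry_c c d a b F G : contdiff (b + 2 + (b + 2)) F ->
  bdry (b + 2) c (fun x => (x - d) ^+ (b + 1) * G x)
    (flux (b + 2) (fun t => (t - c) ^+ (a + (b + 2)))
                  (fun t => (t - d) ^+ (b + 1)) F) = 0.
Proof.
move=> CF; rewrite /flux bdry_eq0 ?leq_addl //.
by apply: contdiff_derive1n; apply: contdiffM => //; exact: contdiff_subrX.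
Qed.

(** (x - d)^(b+1) falls one order short of killing all terms, so the flux appears undifferentiated.
    Inside it b + 1 of the b + 2 derivatives are spent on the power, which leaves F'(d). *)
Lemma endpoint_op_bdry_d c d a b F G :
  contdiff (b + 2 + (b + 2)) F -> contdiff (b + 2) G ->
  bdry (b + 2) d (fun x => (x - d) ^+ (b + 1) * G x)
    (flux (b + 2) (fun t => (t - c) ^+ (a + (b + 2)))
                  (fun t => (t - d) ^+ (b + 1)) F) =
  (-1) ^+ (b + 1) * ((b + 1)`!)%:R * G d *
  ((d - c) ^+ (a + (b + 2)) * (((b + 2) ^_ (b + 1))%:R * derive1 F d)).
Proof.
move=> CF CG; set U := flux _ _ _ _.
have CU : contdiff (b + 2) U by apply: contdiff_flux => //; exact: contdiff_subrX.
have UE : U = fun x => (x - d) ^+ 0 * U x.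
  by apply/funext => x; rewrite expr0 mul1r.
rewrite UE (_ : (b + 2 = (b + 1 + 0).+1)%N); last by lia.
rewrite bdry_one; [|by apply: contdiff_le CG _; lia|by apply: contdiff_le CU _; lia].
rewrite fact0 mulr1 /U /flux derive1nM_subrX_at; last by apply: contdiff_le CF _; lia.
by rewrite (_ : (b + 2 - (b + 1) = 1)%N) ?derive1n1 ?addn0 -?addnS //; lia.
Qed.

(** * Continuous representatives of the operators and their endpoint values *)

Lemma contdiff_addr k c : contdiff k (fun x : R => x + c).
Proof. by have := contdiff_subr k (- c); under eq_fun do rewrite opprK. Qed.

Lemma contdiff_wgt k i j : contdiff k (wgt i j : R -> R).
Proof.
apply: contdiffM; first exact: contdiff_subrX.
by have := contdiff_subrX k (-1 : R) j; under eq_fun do rewrite opprK.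
Qed.

Lemma L2_repr a b f F : contdiff 2 F -> {in `[(-1 : R), 1], F =1 f} ->
  exists K,
    [/\ continuous K, {in `[(-1 : R), 1], L2 a b f =1 K},
        forall x, K x * wgt a b x =
          derive1n 1 (flux 1 (wgt (a + 1) (b + 1)) (fun=> 1) F) x,
        K 1 = 2 * (a + 1)%:R * derive1 F 1 &
        K (-1) = - (2 * (b + 1)%:R * derive1 F (-1))].
Proof.
move=> CF Ff; have [dF [ddF cF]] := CF.
(* The operator expanded by the product rule, with the weight divided out; its coefficients are
   polynomials. *)
pose K x := (a + 1)%:R * (x + 1) * derive1 F x +
  (b + 1)%:R * (x - 1) * derive1 F x + (x - 1) * (x + 1) * derive1 (derive1 F) x.
have KE x : derive1n 1 (flux 1 (wgt (a + 1) (b + 1)) (fun=> 1) F) x = wgt a b x * K x.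
  have -> : flux 1 (wgt (a + 1) (b + 1)) (fun=> 1) F =
      fun x => ((x - 1) ^+ a.+1 * (x - -1) ^+ b.+1) * derive1 F x.
    apply/funext => t; rewrite /flux /wgt !addn1 opprK; congr (_ * _).
    by rewrite derive1n1; congr (derive1 _ t); apply/funext => s; rewrite mul1r.
  have [d1 _] := contdiff_subrX 1 (1 : R) a.+1.
  have [d2 _] := contdiff_subrX 1 (-1 : R) b.+1.
  rewrite derive1n1 derive1M; [|by move=> t; exact: derivableM|exact: ddF].
  rewrite derive1M; [|exact: d1|exact: d2].
  rewrite !derive1_subrX /K /wgt !exprS opprK !addn1; ring.
have CK : contdiff 0 K.
  have C1 : contdiff 0 (derive1 F) by apply: contdiffW.
  have C2 : contdiff 0 (derive1 (derive1 F)) by [].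
  apply: (contdiffD 0 _ _ (contdiffD 0 _ _ (contdiffM 0 _ _ _ C1) (contdiffM 0 _ _ _ C1))
                    (contdiffM 0 _ _ _ C2)).
  - exact: (contdiffM 0 _ _ (contdiff_cst 0 _) (contdiff_addr 0 1)).
  - exact: (contdiffM 0 _ _ (contdiff_cst 0 _) (contdiff_subr 0 1)).
  - exact: (contdiffM 0 _ _ (contdiff_subr 0 1) (contdiff_addr 0 1)).
exists K; split=> //.
- apply: cont_ext_continuous CK _ => x xI.
  move: (xI); rewrite in_itv /= => /andP[x1 x2].
  have <- : 1 / wgt a b x * (wgt a b x * K x) = K x.
    rewrite div1r mulKf // mulf_neq0 // expf_neq0 //; first by rewrite subr_eq0 lt_eqF.
    by rewrite addr_eq0 gt_eqF.
  rewrite -KE; apply: (congr1 (fun z => 1 / wgt a b x * z)).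
  apply: (derive1n_eq_oo 1) xI => {x1 x2} t tI; rewrite /flux /wgt; congr (_ * _).
  apply: (derive1n_eq_oo 1) t tI => s sI; rewrite mul1r; apply/esym/Ff.
  exact: subset_itv_oo_cc sI.
- by move=> x; rewrite KE mulrC.
- by rewrite /K; ring.
- by rewrite /K; ring.
Qed.

Lemma bigop_repr a b f F : contdiff (a + b + 3 + (a + b + 3)) F ->
  {in `[(-1 : R), 1], F =1 f} ->
  exists K,
    [/\ continuous K, {in `[(-1 : R), 1], L2a2b6 a b f =1 K},
        forall x, K x * wgt a b x = wgt (a + 1) (b + 1) x *
          derive1n (a + b + 3) (flux (a + b + 3)
             (wgt (b + 1) (a + 1)) (wgt (a + 1) (b + 1)) F) x,
        K 1 = 0 & K (-1) = 0].
Proof.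
move=> CF Ff; set n := (a + b + 3)%N in CF *.
pose D := derive1n n (flux n (wgt (b + 1) (a + 1)) (wgt (a + 1) (b + 1)) F).
have CD : contdiff 0 D.
  apply: contdiff_derive1n; rewrite addn0.
  by apply: contdiff_flux => //; exact: contdiff_wgt.
pose K x := (x ^+ 2 - 1) * D x.
have CK : contdiff 0 K.
  rewrite (_ : K = fun x => (x - 1) * (x + 1) * D x); last first.
    by apply/funext => x; rewrite /K; ring.
  apply: (contdiffM 0 _ _ _ CD).
  by apply: contdiffM; [exact: contdiff_subr|exact: contdiff_addr].
exists K; split=> //.
- apply: cont_ext_continuous CK _ => x xI; congr (_ * _).
  apply: (derive1n_eq_oo n) x xI => t tI; rewrite /flux /wgt; congr (_ * _).
  apply: (derive1n_eq_oo n) t tI => s sI; congr (_ * _); apply/esym/Ff.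
  exact: subset_itv_oo_cc sI.
- by move=> x; rewrite /K /D /wgt !addn1 !exprS; ring.
- by rewrite /K; ring.
- by rewrite /K; ring.
Qed.

(** The orders a + 1 and b + 1 at c add up to a + b + 2, one less than the number of integrations,
    so one term survives. Its derivative of order b + 2 also occurs in the value at c in
    [endpoint_op_repr], which makes a cancellation possible. *)
Lemma big_bdry c d a b F G :
  contdiff (a + b + 3 + (a + b + 3)) F -> contdiff (a + b + 3) G ->
  bdry (a + b + 3) c (fun x => (x - c) ^+ (a + 1) * (x - d) ^+ (b + 1) * G x)
    (flux (a + b + 3) (fun x => (x - c) ^+ (b + 1) * (x - d) ^+ (a + 1))
                  (fun x => (x - c) ^+ (a + 1) * (x - d) ^+ (b + 1)) F) =
  (-1) ^+ (a + 1) * ((a + 1)`!)%:R * ((b + 1)`!)%:R *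
  ((c - d) ^+ (b + 1) * G c) *
  ((c - d) ^+ (a + 1) * (((a + b + 3) ^_ (a + 1))%:R *
    derive1n (b + 2) (fun t => (t - d) ^+ (b + 1) * F t) c)).
Proof.
move=> CF CG; set n := (a + b + 3)%N in CF CG *.
rewrite /flux.
under [X in bdry _ _ X _]eq_fun do rewrite -mulrA.
under [X in bdry _ _ _ X]eq_fun do rewrite -mulrA.
rewrite [X in bdry X](_ : n = (a + 1 + (b + 1)).+1); last by rewrite /n; lia.
rewrite bdry_one; last 2 first.
- by apply: contdiffM; [exact: contdiff_subrX|apply: contdiff_le CG _; rewrite /n; lia].
- apply: contdiffM; first exact: contdiff_subrX.
  apply: (@contdiff_le _ n); last by rewrite /n; lia.
  by apply: contdiff_derive1n; do 2 (apply: contdiffM => //; try exact: contdiff_subrX).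
congr (_ * (_ * _)).
under eq_fun do rewrite -mulrA.
rewrite derive1nM_subrX_at; last first.
  by apply: contdiffM; [exact: contdiff_subrX|apply: contdiff_le CF _; lia].
by rewrite (_ : (n - (a + 1) = b + 2)%N) // /n; lia.
Qed.

(** The case c = 1, d = -1 of [endpoint_op]. *)
Lemma Ltilde_repr a b f F : contdiff (b + 2 + (b + 2)) F ->
  {in `[(-1 : R), 1], F =1 f} ->
  exists K,
    [/\ continuous K, {in `[(-1 : R), 1], Ltilde b a f =1 K},
        forall x, K x * wgt a b x = (x - -1) ^+ (b + 1) *
          derive1n (b + 2) (flux (b + 2) (fun t => (t - 1) ^+ (a + (b + 2)))
                     (fun t => (t - -1) ^+ (b + 1)) F) x,
        K 1 = 2 * (((a + (b + 2)) ^_ (b + 2))%:R *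
          derive1n (b + 2) (fun t => (t - -1) ^+ (b + 1) * F t) 1) &
        K (-1) = 0].
Proof.
move=> CF Ff; have [K [cK opK KE K1 KN1]] := endpoint_op_repr 1 (-1) a b F CF.
exists K; split=> //.
- apply: cont_ext_continuous cK _ => x xI.
  have x1 : x != 1 by move: xI; rewrite in_itv /= => /andP[_ /lt_eqF ->].
  rewrite -opK // /endpoint_op subrN1; congr (_ * _).
  apply: (eq_flux (b + 2) (fun t => (t - 1) ^+ (a + b + 2))
                          (fun t => (t + 1) ^+ (b + 1))) xI => t.
  + by rewrite addnA.
  + by rewrite opprK.
  + by move=> tI; apply: Ff; exact: subset_itv_oo_cc tI.
- by move=> x; rewrite -KE /wgt subrN1.
- by rewrite K1; congr (_ * _); ring.
Qed.

(** The case c = -1, d = 1 of [endpoint_op], with a and b exchanged. *)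
Lemma L2a4_repr a b f F : contdiff (a + 2 + (a + 2)) F ->
  {in `[(-1 : R), 1], F =1 f} ->
  exists K,
    [/\ continuous K, {in `[(-1 : R), 1], L2a4 a b f =1 K},
        forall x, K x * wgt a b x = (x - 1) ^+ (a + 1) *
          derive1n (a + 2) (flux (a + 2) (fun t => (t - -1) ^+ (b + (a + 2)))
                     (fun t => (t - 1) ^+ (a + 1)) F) x,
        K (-1) = - (2 * (((b + (a + 2)) ^_ (a + 2))%:R *
          derive1n (a + 2) (fun t => (t - 1) ^+ (a + 1) * F t) (-1))) &
        K 1 = 0].
Proof.
move=> CF Ff; have [K [cK opK KE KN1 K1]] := endpoint_op_repr (-1) 1 b a F CF.
exists K; split=> //.
- apply: cont_ext_continuous cK _ => x xI.
  have x1 : x != -1 by move: xI; rewrite in_itv /= => /andP[/gt_eqF ->].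
  rewrite -opK // /endpoint_op subrN1; congr (_ * _).
  apply: (eq_flux (a + 2) (fun t => (t + 1) ^+ (a + b + 2))
                          (fun t => (t - 1) ^+ (a + 1))) xI => t //.
  + by rewrite opprK addnA (addnC a).
  + by move=> tI; apply: Ff; exact: subset_itv_oo_cc tI.
- by move=> x; rewrite -KE /wgt subrN1 [(x + 1) ^+ b * _]mulrC.
- by rewrite KN1 -mulNr; congr (_ * _); ring.
Qed.

End Operators.

(** * Symmetry *)

Section Constants.
Context {R : realType}.
Implicit Types (a b : nat).

Lemma natr_fact_neq0 n : (n`!)%:R != 0 :> R.
Proof. by rewrite pnatr_eq0 -lt0n fact_gt0. Qed.

Lemma poch_fact m k : (poch (m + 1) k * m`! = (m + k)`!)%N.
Proof.
elim: k => [|k IH]; first by rewrite /poch big_ord0 mul1n addn0.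
rewrite [(m + k.+1)%N]addnS factS -IH /poch big_ord_recr /=; lia.
Qed.

Lemma b_cstE a b : (b_cst a b)%:R =
  (a + 2)%:R * (a + 1)%:R * (a`!)%:R * ((a + b + 1)`!)%:R / (b`!)%:R :> R.
Proof.
apply: (mulIf (natr_fact_neq0 b)); rewrite divfK ?natr_fact_neq0 //.
rewrite -!natrM; congr _%:R; rewrite /b_cst -mulnA poch_fact.
rewrite (_ : (a + 2)`! = (a + 2) * (a + 1) * a`!)%N; last first.
  by rewrite addn2 addn1 !factS mulnA.
by congr (_ * _`!)%N; lia.
Qed.

Lemma h_cstC a b : h_cst R a b = h_cst R b a.
Proof. by rewrite !h_cstE (addnC b a); congr (_ / _); ring. Qed.

Lemma c_cstC a b : c_cst a b = c_cst b a.
Proof. by rewrite /c_cst (addnC b a) (mulnC (b + 1)). Qed.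

Lemma ffact_factR n m : (m <= n)%N ->
  (n ^_ m)%:R = (n`!)%:R / ((n - m)`!)%:R :> R.
Proof.
by move=> mn; rewrite -(ffact_fact mn) natrM mulfK // natr_fact_neq0.
Qed.

(** Matches the boundary term of the operator with coefficient N/b at 1 with the value 2(a+1)F'(1)
    of [L2]. Exchanging a and b gives the match at -1. *)
Lemma boundary_cst1 a b :
  (h_cst R a b)^-1 * (((a + 1)`!)%:R * 2 ^+ (b + (a + 2)) *
    ((a + 2) ^_ (a + 1))%:R) / (b_cst a b)%:R = 2 * (a + 1)%:R.
Proof.
rewrite h_cstE b_cstE ffact_factR; last by lia.
rewrite (_ : a + 2 - (a + 1) = 1)%N; last by lia.
rewrite (_ : b + (a + 2) = (a + b + 1).+1)%N; last by lia.
rewrite (_ : (a + 2)`! = (a + 2) * ((a + 1) * a`!))%N; last first.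
  by rewrite addn2 addn1 !factS.
rewrite (_ : (a + 1)`! = (a + 1) * a`!)%N; last by rewrite addn1 factS.
rewrite (_ : 1`! = 1)%N // exprS !natrM.
have := natr_fact_neq0 a; have := natr_fact_neq0 b.
have := natr_fact_neq0 (a + b + 1).
have := (expf_neq0 (a + b + 1) (_ : 2 != 0 :> R)); rewrite pnatr_eq0 => /(_ isT).
have : (a + 1)%:R != 0 :> R by rewrite pnatr_eq0 addn1.
have : (a + 2)%:R != 0 :> R by rewrite pnatr_eq0 addn2.
(* Once the factorials are abstracted, an identity of rational functions is left for [field]. *)
move: (a + 1)%:R (a + 2)%:R (2 ^+ (a + b + 1)) (a`!)%:R (b`!)%:R ((a + b + 1)`!)%:R.
by move=> x y z u v w *; field; rewrite -?[1%:R]/1; do ?[apply/andP; split].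
Qed.

(** Matches the boundary term of the operator with coefficient MN/c at 1 with the value of [Ltilde]
    there; exchanging a and b serves -1 and [L2a4]. *)
Lemma boundary_cst2 a b :
  (h_cst R a b)^-1 * (((a + 1)`!)%:R * ((b + 1)`!)%:R * 2 ^+ (a + b + 2) *
    ((a + b + 3) ^_ (a + 1))%:R) / (c_cst a b)%:R =
  2 * ((a + (b + 2)) ^_ (b + 2))%:R / (b_cst b a)%:R.
Proof.
rewrite h_cstE b_cstE /c_cst !ffact_factR; try lia.
rewrite (_ : a + b + 3 - (a + 1) = b + 2)%N; last by lia.
rewrite (_ : a + (b + 2) - (b + 2) = a)%N; last by lia.
rewrite (_ : a + b + 2 = (a + b + 1).+1)%N; last by lia.
rewrite (_ : (a + (b + 2))`! = (a + b + 2) * (a + b + 1)`!)%N; last first.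
  by rewrite (_ : a + (b + 2) = (a + b + 1).+1)%N ?factS; lia.
rewrite (_ : (a + b + 3)`! = (a + b + 3) * ((a + b + 2) * (a + b + 1)`!))%N; last first.
  by rewrite (_ : a + b + 3 = (a + b + 1).+2)%N ?factS; lia.
rewrite (_ : (b + 2)`! = (b + 2) * ((b + 1) * b`!))%N; last first.
  by rewrite addn2 addn1 !factS.
rewrite (_ : (a + 1)`! = (a + 1) * a`!)%N; last by rewrite addn1 factS.
rewrite (_ : (b + 1)`! = (b + 1) * b`!)%N; last by rewrite addn1 factS.
rewrite (addnC b a) exprS !natrM ?natrX.
have := natr_fact_neq0 a; have := natr_fact_neq0 b.
have := natr_fact_neq0 (a + b + 1).
have := (expf_neq0 (a + b + 1) (_ : 2 != 0 :> R)); rewrite pnatr_eq0 => /(_ isT).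
have : (a + 1)%:R != 0 :> R by rewrite pnatr_eq0 addn1.
have : (b + 1)%:R != 0 :> R by rewrite pnatr_eq0 addn1.
have : (b + 2)%:R != 0 :> R by rewrite pnatr_eq0 addn2.
have : (a + b + 3)%:R != 0 :> R by rewrite pnatr_eq0 addn3.
move: (a + 1)%:R (b + 1)%:R (b + 2)%:R (a + b + 2)%:R (a + b + 3)%:R
  (2 ^+ (a + b + 1)) (a`!)%:R (b`!)%:R ((a + b + 1)`!)%:R.
by move=> x y z u v w *; field; do ?[apply/andP; split].
Qed.

End Constants.

(** * Cancellation of the point masses *)

Section Symmetry.
Context {R : realType}.
Local Open Scope classical_set_scope.
Local Open Scope ring_scope.
Implicit Types (f g F G K p q : R -> R) (c d x : R) (a b n : nat).

Lemma Int_flux n p q F G :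
  contdiff n p -> contdiff (n + n) q -> contdiff (n + n) F -> contdiff n G ->
  Int (fun x => G x * (q x * derive1n n (flux n p q F) x)) =
  bdry n 1 (fun x => q x * G x) (flux n p q F) -
  bdry n (-1) (fun x => q x * G x) (flux n p q F) +
  (-1) ^+ n * energy n p q F G.
Proof.
move=> Cp Cq CF CG; rewrite -Int_by_parts_iter.
- by apply: eq_Int => x _; ring.
- by apply: contdiffM => //; apply: contdiff_le Cq _; exact: leq_addr.
- exact: contdiff_flux.
Qed.

(** Collects the signs at the endpoint -1: (-1)^k from writing the weight with x - 1, (-1)^l from
    the integrations by parts, and powers of -1 - 1 from c - d. The total exponent is odd. *)
Lemma sign_cancel k l i j n :
  (i + j + k + l)%N = n.*2.+1 ->
  (-1) ^+ k * ((-1) ^+ l * (-1 - 1) ^+ i * (-1 - 1) ^+ j) = - 2 ^+ (i + j) :> R.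
Proof.
move=> e; rewrite (_ : -1 - 1 = (-1) * 2 :> R); last by ring.
rewrite -mulrA -exprD exprMn !mulrA -!exprD (_ : k + l + (i + j) = n.*2.+1)%N; last first.
  by rewrite -e; lia.
by rewrite exprS -mul2n exprM sqrrN expr1n expr1n mulr1 mulN1r.
Qed.

(** All evaluations at -1 and 1 cancel, and only energies, symmetric in [F] and [G], remain. *)
Lemma sprod_LMN a b (M N : R) f g F G :
  contdiff (2 * a + 2 * b + 6) F -> contdiff (2 * a + 2 * b + 6) G ->
  {in `[(-1 : R), 1], F =1 f} -> {in `[(-1 : R), 1], G =1 g} ->
  sprod_wMN a b M N (LMN a b M N f) g =
  (h_cst R a b)^-1 * ((-1) ^+ a * (
    - energy 1 (wgt (a + 1) (b + 1)) (fun=> 1) F G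
    + M / (b_cst b a)%:R * ((-1) ^+ (b + 2) *
        energy (b + 2) (fun t => (t - 1) ^+ (a + (b + 2)))
          (fun t => (t - -1) ^+ (b + 1)) F G)
    + N / (b_cst a b)%:R * ((-1) ^+ (a + 2) *
        energy (a + 2) (fun t => (t - -1) ^+ (b + (a + 2)))
          (fun t => (t - 1) ^+ (a + 1)) F G)
    + M * N / (c_cst a b)%:R * ((-1) ^+ (a + b + 3) *
        energy (a + b + 3) (wgt (b + 1) (a + 1)) (wgt (a + 1) (b + 1)) F G))).
Proof.
move=> CF CG Ff Gg.
have CFk k : (k <= 2 * a + 2 * b + 6)%N -> contdiff k F by exact: contdiff_le.
have CGk k : (k <= 2 * a + 2 * b + 6)%N -> contdiff k G by exact: contdiff_le.
have [|K2 [c2 e2 w2 v2 u2]] := L2_repr a b f F _ Ff; first by apply: CFk; lia.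
have [|K3 [c3 e3 w3 v3 u3]] := Ltilde_repr a b f F _ Ff; first by apply: CFk; lia.
have [|K4 [c4 e4 w4 u4 v4]] := L2a4_repr a b f F _ Ff; first by apply: CFk; lia.
have [|K5 [c5 e5 w5 v5 u5]] := bigop_repr a b f F _ Ff; first by apply: CFk; lia.
pose W K := Int (fun x => G x * (K x * wgt a b x)).
have I1 : 1 \in `[(-1 : R), 1] by rewrite in_itv /=; apply/andP; split; lra.
have IN1 : -1 \in `[(-1 : R), 1] by rewrite in_itv /=; apply/andP; split; lra.
(* The point masses now involve only the known endpoint values of the four representatives. *)
rewrite /sprod_wMN /LMN !(e2, e3, e4, e5) //= v2 v3 v4 v5 u2 u3 u4 u5 -!Gg //.
set tm := M / _; set tn := N / _; set tmn := M * N / _.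
have -> : sprod_w a b (LMN a b M N f) g =
    (h_cst R a b)^-1 * ((-1) ^+ a * (W K2 + tm * W K3 + tn * W K4 + tmn * W K5)).
  have CW K : continuous K -> contdiff 0 (fun x => G x * (K x * wgt a b x)).
    move=> cK; apply: (contdiffM 0); first exact: CGk.
    by apply: (contdiffM 0) => //; exact: contdiff_wgt.
  have CZ r K : continuous K -> continuous (fun x => r * (G x * (K x * wgt a b x))).
    by move=> cK; exact: (contdiffM 0 _ _ (contdiff_cst 0 _) (CW K cK)).
  have <- : Int (fun x => G x * (K2 x * wgt a b x) + tm * (G x * (K3 x * wgt a b x))
      + tn * (G x * (K4 x * wgt a b x)) + tmn * (G x * (K5 x * wgt a b x))) =
      W K2 + tm * W K3 + tn * W K4 + tmn * W K5.
    have C2 := CW _ c2; have C3 := CZ tm _ c3; have C4 := CZ tn _ c4.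
    rewrite IntD; [|exact: (contdiffD 0 _ _ (contdiffD 0 _ _ C2 C3) C4)|exact: CZ].
    rewrite IntD; [|exact: (contdiffD 0 _ _ C2 C3)|exact: C4].
    rewrite IntD; [|exact: C2|exact: C3].
    by rewrite !IntZl //; exact: CW.
  rewrite /sprod_w -[X in _ = _ * X]IntZl; last first.
    have C2 := CW _ c2; have C3 := CZ tm _ c3; have C4 := CZ tn _ c4.
    exact: (contdiffD 0 _ _ (contdiffD 0 _ _ (contdiffD 0 _ _ C2 C3) C4) (CZ tmn _ c5)).
  congr (_ * _); apply: eq_Int => x xI.
  rewrite /LMN e2 // e3 // e4 // e5 // Gg // opp_subrX /wgt (addrC 1 x) -/tm -/tn -/tmn.
  by ring.
have WE n p q K : (n + n <= 2 * a + 2 * b + 6)%N -> contdiff n p -> contdiff (n + n) q ->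
    (forall x, K x * wgt a b x = q x * derive1n n (flux n p q F) x) ->
    W K = bdry n 1 (fun x => q x * G x) (flux n p q F) -
      bdry n (-1) (fun x => q x * G x) (flux n p q F) +
      (-1) ^+ n * energy n p q F G.
  move=> nm Cp Cq KE; rewrite -Int_flux //.
  - by apply: eq_Int => x _; rewrite KE.
  - exact: CFk.
  - by apply: CGk; lia.
(* With n = 1 both boundary terms contain the factor (x - 1)^(a+1) (x + 1)^(b+1), which vanishes at
   both endpoints. *)
have -> : W K2 = - energy 1 (wgt (a + 1) (b + 1)) (fun=> 1) F G.
  rewrite (WE 1 (wgt (a + 1) (b + 1)) (fun=> 1)).
  - rewrite /bdry !big_ord1 /flux /wgt !derive1n0 subrr addNr.
    by rewrite !addn1 !expr0n /= !exprS; ring.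
  - lia.
  - exact: contdiff_wgt.
  - exact: contdiff_cst.
  - by move=> x; rewrite w2 mul1r.
(* Only -1 contributes; the resulting term will cancel the point mass of [L2] there. *)
have H3 : (-1) ^+ a * W K3 = ((b + 1)`!)%:R * 2 ^+ (a + (b + 2)) *
    ((b + 2) ^_ (b + 1))%:R * (derive1 F (-1) * G (-1)) +
    (-1) ^+ a * ((-1) ^+ (b + 2) *
        energy (b + 2) (fun t => (t - 1) ^+ (a + (b + 2)))
          (fun t => (t - -1) ^+ (b + 1)) F G).
  rewrite (WE _ _ _ _ _ _ _ w3); [|lia|exact: contdiff_subrX|exact: contdiff_subrX].
  rewrite endpoint_op_bdry_c; last by apply: CFk; lia.
  rewrite endpoint_op_bdry_d; [|by apply: CFk; lia|by apply: CGk; lia].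
  have := sign_cancel a (b + 1) 0 (a + (b + 2)) (a + b + 1).
  rewrite expr0 mulr1 add0n => S.
  set E := energy _ _ _ _ _; set x := (-1) ^+ (b + 1) in S *.
  set z := (-1 - 1) ^+ _ in S *.
  rewrite [LHS](_ : _ = - ((-1) ^+ a * (x * z)) * (((b + 1)`!)%:R *
      ((b + 2) ^_ (b + 1))%:R * (derive1 F (-1) * G (-1))) +
      (-1) ^+ a * ((-1) ^+ (b + 2) * E)); last by ring.
  by rewrite S; [ring|lia].
have s2 : (-1) ^+ a * (-1) ^+ (a + 1) = -1 :> R.
  by rewrite addn1 exprS mulrCA -expr2 sqrr_sign mulr1.
have e2' : 1 - -1 = 2 :> R by ring.
(* Here only 1 contributes, with the opposite sign, as needed against the point mass of [L2] at
   1. *)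
have H4 : (-1) ^+ a * W K4 = - (((a + 1)`!)%:R * 2 ^+ (b + (a + 2)) *
    ((a + 2) ^_ (a + 1))%:R) * (derive1 F 1 * G 1) +
    (-1) ^+ a * ((-1) ^+ (a + 2) *
        energy (a + 2) (fun t => (t - -1) ^+ (b + (a + 2)))
          (fun t => (t - 1) ^+ (a + 1)) F G).
  rewrite (WE _ _ _ _ _ _ _ w4); [|lia|exact: contdiff_subrX|exact: contdiff_subrX].
  rewrite endpoint_op_bdry_c; last by apply: CFk; lia.
  rewrite endpoint_op_bdry_d; [|by apply: CFk; lia|by apply: CGk; lia].
  set E := energy _ _ _ _ _; rewrite e2'; set x := (-1) ^+ (a + 1) in s2 *.
  rewrite [LHS](_ : _ = ((-1) ^+ a * x) * (((a + 1)`!)%:R * 2 ^+ (b + (a + 2)) *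
      ((a + 2) ^_ (a + 1))%:R * (derive1 F 1 * G 1)) +
      (-1) ^+ a * ((-1) ^+ (a + 2) * E)); last by ring.
  by rewrite s2; ring.
(* [y1] and [yN1] are the derivatives shared by the endpoint values of [K3] and [K4] and the
   boundary terms of the operator of highest order. *)
pose y1 := derive1n (b + 2) (fun t => (t - -1) ^+ (b + 1) * F t) 1.
pose yN1 := derive1n (a + 2) (fun t => (t - 1) ^+ (a + 1) * F t) (-1).
have H5 : (-1) ^+ a * W K5 =
    - (((a + 1)`!)%:R * ((b + 1)`!)%:R * 2 ^+ (a + b + 2) *
       ((a + b + 3) ^_ (a + 1))%:R) * (y1 * G 1) +
    (((b + 1)`!)%:R * ((a + 1)`!)%:R * 2 ^+ (b + a + 2) *
       ((b + a + 3) ^_ (b + 1))%:R) * (yN1 * G (-1)) +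
    (-1) ^+ a * ((-1) ^+ (a + b + 3) *
        energy (a + b + 3) (wgt (b + 1) (a + 1)) (wgt (a + 1) (b + 1)) F G).
  rewrite (WE _ _ _ _ _ _ _ w5); [|lia|exact: contdiff_wgt|exact: contdiff_wgt].
  set E := energy _ _ _ _ _.
  have wE i j : wgt i j = fun x : R => (x - 1) ^+ i * (x - -1) ^+ j.
    by apply/funext => x; rewrite /wgt opprK.
  have wE' i j : wgt i j = fun x : R => (x - -1) ^+ j * (x - 1) ^+ i.
    by apply/funext => x; rewrite /wgt opprK mulrC.
  have -> : bdry (a + b + 3) 1 (fun x => wgt (a + 1) (b + 1) x * G x)
      (flux (a + b + 3) (wgt (b + 1) (a + 1)) (wgt (a + 1) (b + 1)) F) =
      (-1) ^+ (a + 1) * (((a + 1)`!)%:R * ((b + 1)`!)%:R * 2 ^+ (a + b + 2) *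
       ((a + b + 3) ^_ (a + 1))%:R * (y1 * G 1)).
    rewrite !wE big_bdry; [|by apply: CFk; lia|by apply: CGk; lia].
    rewrite e2' -/y1 (_ : a + b + 2 = (a + 1) + (b + 1))%N; last by lia.
    by rewrite [2 ^+ (a + 1 + (b + 1))]exprD; ring.
  have -> : bdry (a + b + 3) (-1) (fun x => wgt (a + 1) (b + 1) x * G x)
      (flux (a + b + 3) (wgt (b + 1) (a + 1)) (wgt (a + 1) (b + 1)) F) =
      (-1) ^+ (b + 1) * (-1 - 1) ^+ (a + 1) * (-1 - 1) ^+ (b + 1) *
      (((b + 1)`!)%:R * ((a + 1)`!)%:R *
       ((b + a + 3) ^_ (b + 1))%:R * (yN1 * G (-1))).
    rewrite !wE' (addnC a b) big_bdry; [|by apply: CFk; lia|by apply: CGk; lia].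
    by rewrite -/yN1; ring.
  have := sign_cancel a (b + 1) (a + 1) (b + 1) (a + b + 1).
  rewrite (_ : a + 1 + (b + 1) = b + a + 2)%N; last by lia.
  move=> S.
  set x := (-1) ^+ (a + 1) in s2 *; set t := (-1) ^+ (b + 1) * _ * _ in S *.
  set P := _ * (y1 * G 1); set Q := _ * (yN1 * G (-1)).
  rewrite [LHS](_ : _ = (-1) ^+ a * x * P - (-1) ^+ a * t * Q
     + (-1) ^+ a * ((-1) ^+ (a + b + 3) * E)); last by ring.
  by rewrite s2 S /P /Q; [ring|lia].
(* Four cancellations: [B1] for F'(1)G(1), [B2] for F'(-1)G(-1), [B3] for y1 G(1), [B4] for yN1
   G(-1). [B2] and [B4] come from exchanging a and b, under which h and c are invariant. *)
have B1 := @boundary_cst1 R a b; have B2 := @boundary_cst1 R b a.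
have B3 := @boundary_cst2 R a b; have B4 := @boundary_cst2 R b a.
rewrite h_cstC in B2; rewrite h_cstC c_cstC in B4.
set E2 := energy 1 _ _ _ _.
rewrite [(-1) ^+ a * (_ + tmn * W K5)](_ : _ = - (-1) ^+ a * E2 +
  tm * ((-1) ^+ a * W K3) + tn * ((-1) ^+ a * W K4) + tmn * ((-1) ^+ a * W K5));
  last by ring.
rewrite H3 H4 H5 -/y1 -/yN1 /tm /tn /tmn.
move: B1 B2 B3 B4.
set Y1 := _ * _ * ((a + 2) ^_ (a + 1))%:R.
set Y2 := _ * _ * ((b + 2) ^_ (b + 1))%:R.
set Y3 := _ * _ * ((a + b + 3) ^_ (a + 1))%:R.
set Y4 := _ * _ * ((b + a + 3) ^_ (b + 1))%:R.
set hi := (h_cst R a b)^-1 => B1 B2 B3 B4.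
rewrite -B1 -B2.
have B3' : 2 * (((a + (b + 2)) ^_ (b + 2))%:R * y1) / (b_cst b a)%:R =
    hi * Y3 / (c_cst a b)%:R * y1 by rewrite B3; ring.
have B4' : 2 * (((b + (a + 2)) ^_ (a + 2))%:R * yN1) / (b_cst a b)%:R =
    hi * Y4 / (c_cst a b)%:R * yN1 by rewrite B4; ring.
rewrite [M / _ * (2 * _)](_ : _ = M * (hi * Y3 / (c_cst a b)%:R * y1)); last first.
  by rewrite -B3'; ring.
rewrite [N / _ * - (2 * _)](_ : _ = - N * (hi * Y4 / (c_cst a b)%:R * yN1)); last first.
  by rewrite -B4'; ring.
by ring.
Qed.

End Symmetry.

Theorem theorem3p1 (R : realType) (alpha beta : nat) (M N : R)
    (M_gt0 : 0 < M) (N_gt0 : 0 < N) (f g : R -> R)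
    (Cf : Ck (2 * alpha + 2 * beta + 6)%N f)
    (Cg : Ck (2 * alpha + 2 * beta + 6)%N g) :
  sprod_wMN alpha beta M N (LMN alpha beta M N f) g =
  sprod_wMN alpha beta M N f (LMN alpha beta M N g).
Proof.
have [F [CF Ff]] := Ck_extension _ _ Cf; have [G [CG Gg]] := Ck_extension _ _ Cg.
(* By commutativity the right side becomes the scalar product of the operator on g with f, so one
   formula covers both sides with [F] and [G] exchanged. *)
have sprodC y z : sprod_wMN alpha beta M N y z = sprod_wMN alpha beta M N z y.
  rewrite /sprod_wMN /sprod_w.
  under eq_Rintegral do rewrite [y _ * z _]mulrC.
  by ring.
rewrite [RHS]sprodC !(sprod_LMN alpha beta M N _ _ _ _ CF CG Ff Gg).
rewrite !(sprod_LMN alpha beta M N _ _ _ _ CG CF Gg Ff).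
by rewrite !(energyC _ _ _ F G).
Qed.
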